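(* Let $S^{FR}$ be the set of size $k$ selected by Forward Regression, and let $\mathrm{OPT}=\max_{S\subseteq V,\,|S|=k}R^2_{Z,S}$. Then $S^{FR}$ has the following approximation guarantees: $$\begin{aligned}R^2_{Z,S^{FR}}&\ge\bigl(1-e^{-\gamma_{S^{FR},k}}\bigr)\cdot\mathrm{OPT}\\&\ge\bigl(1-e^{-\lambda_{\min}(C,2k)}\bigr)\cdot\mathrm{OPT}\\&\ge\bigl(1-e^{-\lambda_{\min}(C,k)}\bigr)\cdot\Theta\Bigl(\bigl(\tfrac12\bigr)^{1/\lambda_{\min}(C,k)}\Bigr)\cdot\mathrm{OPT}.\end{aligned}$$
   Context: Setting: $Z$ and $V=\{X_1,\dots,X_n\}$ are real random variables with mean $0$ and variance $1$, and $k\le n$ is a positive integer. $C=(\mathrm{Cov}(X_i,X_j))_{i,j}$ is the covariance matrix of the $X_i$ and $\mathbf b=(\mathrm{Cov}(Z,X_i))_i$. For $S\subseteq V$ (identified with its index set), $C_S$ is the submatrix of $C$ with rows and columns in $S$ and $\mathbf b_S$ is the restriction of $\mathbf b$ to $S$. It is assumed throughout that the matrices $C_S$ are non-singular. The squared multiple correlation is $R^2_{Z,S}=1-\min_{\alpha}E[(Z-\sum_{i\in S}\alpha_iX_i)^2]=\mathbf b_S^{T}C_S^{-1}\mathbf b_S$ (and $R^2_{Z,\emptyset}=0$). Submodularity ratio: for $U\subseteq V$ and $k\ge1$, $$\gamma_{U,k}=\min_{L\subseteq U,\ S\subseteq V,\ |S|\le k,\ S\cap L=\emptyset}\frac{\sum_{i\in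 S}\bigl(R^2_{Z,L\cup\{X_i\}}-R^2_{Z,L}\bigr)}{R^2_{Z,S\cup L}-R^2_{Z,L}},$$ with the convention $0/0=1$. Sparse eigenvalues: $\lambda_{\min}(C,m)=\min_{S:|S|=m}\lambda_{\min}(C_S)$ for $1\le m\le n$, where $\lambda_{\min}(\cdot)$ of a matrix is its smallest eigenvalue; for $m>n$ put $\lambda_{\min}(C,m)=\lambda_{\min}(C)$. Forward Regression: start with $S_0=\emptyset$; in iteration $i+1$ choose a variable $X_m$ maximizing $R^2_{Z,S_i\cup\{X_m\}}$ and set $S_{i+1}=S_i\cup\{X_m\}$; output $S_k$.
   Formalization: The third bound is proved as a lower bound on R²_{Z,S^FR} itself, not as a consequence of the second: that last link of the chain is false for uniform Θ constants (n=2, k=1, Cov(X₁,X₂)→1, Z=X₁). *)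

(* Defs.v *)
From HB Require Import structures.
From mathcomp Require Export all_boot all_order all_algebra.
From mathcomp Require Export all_classical all_reals all_analysis.
Export Order.TTheory GRing.Theory Num.Theory.
Export numFieldNormedType.Exports.

Set Implicit Arguments.
Unset Strict Implicit.
Unset Printing Implicit Defensive.

Local Open Scope ring_scope.
Local Open Scope classical_set_scope.

(* A set S of variables is represented by its index set, a {set 'I_n}.
   The minima and maxima below range over nonempty finite sets of reals (or,
   for the least squares error, are attained), hence are written as inf/sup. *)

Section SparseEigenvalues.
Variables (R : realType) (n : nat).

Definition principal_submx (C : 'M[R]_n) (S : {set 'I_n}) : 'M[R]_#|S| :=
  mxsub enum_val enum_val C.

Definition lambda_min (m : nat) (M : 'M[R]_m) : R :=
  inf [set a : R | eigenvalue M a].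

Definition sparse_lambda_min (C : 'M[R]_n) (m : nat) : R :=
  if (m <= n)%N
  then inf [set lambda_min (principal_submx C S) | S in [set S : {set 'I_n} | #|S| = m]]
  else lambda_min C.

End SparseEigenvalues.

(* The quotient a / b with the convention 0 / 0 = 1. *)
Definition quot01 (R : realType) (a b : R) : R :=
  if (a == 0) && (b == 0) then 1 else a / b.

Section Regression.
Context {d : measure_display} {T : measurableType d} {R : realType}.
Variables (P : probability T R) (n : nat).
Variables (Z : {RV P >-> R}) (X : 'I_n -> {RV P >-> R}).

Definition cov_mx : 'M[R]_n := \matrix_(i, j) fine (covariance P (X i) (X j)).

Definition sq_error (S : {set 'I_n}) (alpha : 'I_n -> R) : \bar R :=
  ('E_P[fun t => (Z t - \sum_(i in S) alpha i * X i t) ^+ 2 : R]%R)%E.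

(* The squared multiple correlation R^2_{Z,S}. *)
Definition R2 (S : {set 'I_n}) : R :=
  1 - fine (ereal_inf [set sq_error S alpha | alpha in [set: 'I_n -> R]]).

Definition submodularity_ratio (U : {set 'I_n}) (k : nat) : R :=
  inf [set x : R | exists L S : {set 'I_n},
    [/\ L \subset U, (#|S| <= k)%N, S :&: L = finset.set0 &
        x = quot01 (\sum_(i in S) (R2 (i |: L) - R2 L))
                   (R2 (S :|: L) - R2 L)]].

Definition OPT (k : nat) : R :=
  sup [set R2 S | S in [set S : {set 'I_n} | #|S| = k]].

(* SFR is a possible output of k iterations of Forward Regression, ties being
   broken arbitrarily. Each iteration picks a new variable, so #|SFR| = k;
   R2 is monotone, so some maximizer is always new. *)
Definition forward_regression (k : nat) (SFR : {set 'I_n}) : Prop :=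
  exists s : nat -> {set 'I_n},
    [/\ s 0%N = finset.set0,
        (forall i, (i < k)%N -> exists m : 'I_n,
           [/\ m \notin s i,
               (forall m' : 'I_n, R2 (m' |: s i) <= R2 (m |: s i)) &
               s i.+1 = m |: s i]) &
        s k = SFR].

End Regression.

(* f = Theta(g), uniformly on A, for positive functions. *)
Definition Theta_on (R : realType) (A : set R) (g f : R -> R) : Prop :=
  exists c1 c2 : R, [/\ 0 < c1, 0 < c2 &
    forall x, A x -> c1 * g x <= f x <= c2 * g x].

(* Main.v *)
(** The value R^2_{Z,S} is the maximum of the concave quadratic
    q(x) = 2 b.x - x C x^T over the vectors x supported in S. Moving
    along one coordinate bounds the gain of a single variable from below, and
    the sparse eigenvalue bounds the joint gain of a set from above, so that
    the submodularity ratio is at least lambda(2k). The classical greedy recursion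
    OPT - R^2(S_{i+1}) <= (1 - g / k) (OPT - R^2(S_i)) then gives the guarantee
    1 - e^(-g), for g the submodularity ratio or a sparse eigenvalue.

    For the last bound put a = 1 / lambda(k). Discarding the variables of an
    optimal k-set one at a time, always the one with the smallest coefficient,
    leaves a set of size k/2 of value at least ((k/2 - a) / (k - a))^a OPT,
    which is of order 2^-a OPT as soon as k >= 8 (1 + a)^2; the first k/2
    greedy steps compete with that set. For smaller k the first greedy step
    alone is enough. *)

Require Import Defs.
From mathcomp Require Import all_boot all_order all_algebra.
From mathcomp Require Import all_classical all_reals all_analysis.
From mathcomp Require Import ring lra zify.

Local Open Scope ring_scope.
Local Open Scope classical_set_scope.

(** * Bilinear and quadratic forms on row vectors *)

Section DotProduct.
Set Implicit Arguments.
Unset Strict Implicit.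
Variables (R : realType) (n : nat).
Implicit Types (x y z : 'rV[R]_n) (A : 'M[R]_n).

Definition dotv x y : R := (x *m y^T) 0 0.

Lemma dotvE x y : dotv x y = \sum_i x 0 i * y 0 i.
Proof. by rewrite /dotv mxE; under eq_bigr do rewrite mxE. Qed.

Lemma dotvC x y : dotv x y = dotv y x.
Proof. by rewrite !dotvE; apply: eq_bigr => i _; rewrite mulrC. Qed.

Lemma dotvDl x y z : dotv (x + y) z = dotv x z + dotv y z.
Proof. by rewrite /dotv mulmxDl mxE. Qed.

Lemma dotvZl a x y : dotv (a *: x) y = a * dotv x y.
Proof. by rewrite /dotv -scalemxAl mxE. Qed.

Lemma dotvDr x y z : dotv x (y + z) = dotv x y + dotv x z.
Proof. by rewrite dotvC dotvDl !(dotvC x). Qed.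

Lemma dotvZr a x y : dotv x (a *: y) = a * dotv x y.
Proof. by rewrite dotvC dotvZl dotvC. Qed.

Lemma dotvNl x y : dotv (- x) y = - dotv x y.
Proof. by rewrite -scaleN1r dotvZl mulN1r. Qed.

Lemma dotv_mulmxl A x y : dotv (x *m A) y = dotv x (y *m A^T).
Proof. by rewrite /dotv trmx_mul trmxK mulmxA. Qed.

Lemma dotv_delta x i : dotv x (delta_mx 0 i) = x 0 i.
Proof.
rewrite dotvE (bigD1 i)//= big1 ?addr0 => [|j ji];
  rewrite !mxE/= ?eqxx ?mulr1//.
by rewrite (negbTE ji) mulr0.
Qed.

Lemma dotvv_ge0 x : 0 <= dotv x x.
Proof. by rewrite dotvE sumr_ge0// => i _; rewrite -expr2 sqr_ge0. Qed.

Lemma sqr_le_dotvv x i : x 0 i ^+ 2 <= dotv x x.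
Proof.
rewrite dotvE (bigD1 i)//= -expr2 lerDl sumr_ge0// => j _.
by rewrite -expr2 sqr_ge0.
Qed.

Lemma dotvv_eq0 x : (dotv x x == 0) = (x == 0).
Proof.
apply/eqP/eqP => [x0|->]; last by rewrite /dotv mul0mx mxE.
apply/rowP => i; rewrite mxE; apply/eqP; rewrite -sqrf_eq0 eq_le sqr_ge0 andbT.
by rewrite -x0 sqr_le_dotvv.
Qed.

Definition sym_mx A := A^T = A.

Definition psd_mx A := forall x, 0 <= dotv (x *m A) x.

Lemma dotv_symC A x y : sym_mx A -> dotv (x *m A) y = dotv (y *m A) x.
Proof. by move=> sA; rewrite dotv_mulmxl sA dotvC. Qed.

Lemma dotv_sqD A x y t : sym_mx A -> dotv ((x + t *: y) *m A) (x + t *: y) =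
  dotv (x *m A) x + 2 * t * dotv (x *m A) y + t ^+ 2 * dotv (y *m A) y.
Proof.
move=> sA; rewrite mulmxDl -scalemxAl !(dotvDl, dotvDr, dotvZl, dotvZr).
by rewrite (dotv_symC y x sA); ring.
Qed.

(** Each product [x_i x_j] is at most [|x|^2] in absolute value, so the absolute values of the
    entries add up to a valid constant. *)
Lemma quad_form_bounded A :
  exists2 K : R, 0 < K & forall x, dotv (x *m A) x <= K * dotv x x.
Proof.
(* The summand 1 keeps the constant positive even for [A = 0]. *)
exists (1 + \sum_i \sum_j `|A i j|).
  by rewrite ltr_wpDr// sumr_ge0// => i _; rewrite sumr_ge0.
move=> x.
apply: (@le_trans _ _ ((\sum_i \sum_j `|A i j|) * dotv x x)); last first.
  by rewrite ler_wpM2r ?dotvv_ge0// lerDr.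
rewrite dotvE; under eq_bigr do rewrite mxE big_distrl/=.
rewrite exchange_big big_distrl/= ler_sum// => i _.
rewrite big_distrl/= ler_sum// => j _.
rewrite -mulrA mulrCA; have := sqr_le_dotvv x i; have := sqr_le_dotvv x j.
move: (dotv x x) (x 0 i) (x 0 j) (A i j) => q u v a vq uq.
rewrite (le_trans (ler_norm _))// normrM ler_wpM2l//.
by rewrite ler_norml; apply/andP; split; nra.
Qed.

(* With y = x A^-1, nonnegativity of the form at t x - y reads
   0 <= t^2 (xAx) - 2 t |x|^2 + x A^-1 x; then take t = K, where x A^-1 x <= K |x|^2. *)
Lemma psd_unit_coercive A : sym_mx A -> psd_mx A -> A \in unitmx ->
  exists2 c : R, 0 < c & forall x, c * dotv x x <= dotv (x *m A) x.
Proof.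
move=> sA pA uA; have [K K0 hK] := quad_form_bounded (invmx A).
exists K^-1; first by rewrite invr_gt0.
move=> x; pose y := x *m invmx A.
have yA : y *m A = x by rewrite /y mulmxKV.
have := pA (y + (- K) *: x); rewrite dotv_sqD// yA.
have := hK x; rewrite -/y (dotvC y) => h1 h2.
rewrite ler_pdivrMl//; nra.
Qed.

End DotProduct.

(** * The smallest eigenvalue and the Rayleigh quotient *)

Section Rayleigh.
Set Implicit Arguments.
Unset Strict Implicit.
Variables (R : realType).

Lemma eigenvalue_quad (n : nat) (M : 'M[R]_n) (c a : R) :
  (forall x, c * dotv x x <= dotv (x *m M) x) -> eigenvalue M a -> c <= a.
Proof.
move=> h /eigenvalueP[v vM v0]; have := h v; rewrite vM dotvZl.
by rewrite ler_pM2r// lt_def dotvv_eq0 v0 dotvv_ge0.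
Qed.

(* The infimum r of the Rayleigh quotient is an eigenvalue: otherwise M - r is
   positive semidefinite and invertible, hence coercive, and r is not the
   infimum. *)
Lemma rayleigh_eigenvalue (n : nat) (M : 'M[R]_n) : (0 < n)%N -> sym_mx M ->
  exists2 r, eigenvalue M r & forall x, r * dotv x x <= dotv (x *m M) x.
Proof.
move=> n0 sM.
pose E := [set dotv (x *m M) x / dotv x x | x in [set x : 'rV[R]_n | x != 0]].
have dot0 (x : 'rV[R]_n) : x != 0 -> 0 < dotv x x.
  by move=> x0; rewrite lt_def dotvv_eq0 x0 dotvv_ge0.
have E0 : E !=set0.
  exists (dotv ((const_mx 1 : 'rV[R]_n) *m M) (const_mx 1) /
     dotv (const_mx 1 : 'rV[R]_n) (const_mx 1)); exists (const_mx 1) => //=.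
  by apply/eqP => /rowP/(_ (Ordinal n0)) /eqP; rewrite !mxE oner_eq0.
have lE : has_lbound E.
  have [K K0 hK] := quad_form_bounded (- M).
  exists (- K) => _ [x x0 <-]; rewrite ler_pdivlMr ?dot0//.
  by have := hK x; rewrite mulmxN dotvNl; lra.
have hr x : inf E * dotv x x <= dotv (x *m M) x.
  have [->|x0] := eqVneq x 0; first by rewrite mul0mx /dotv mul0mx !mxE mulr0.
  by rewrite -ler_pdivlMr ?dot0//; apply: ge_inf => //; exists x.
exists (inf E) => //; rewrite /eigenvalue /eigenspace kermx_eq0 row_free_unit.
apply/negP => uA; have [||c c0 hc] := psd_unit_coercive _ _ uA.
- by rewrite /sym_mx linearB/= sM tr_scalar_mx.
- by move=> x; rewrite mulmxBr dotvDl dotvNl mul_mx_scalar dotvZl subr_ge0.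
have : inf E + c <= inf E.
  apply: lb_le_inf => // _ [x x0 <-]; rewrite ler_pdivlMr ?dot0//.
  by have := hc x; rewrite mulmxBr dotvDl dotvNl mul_mx_scalar dotvZl; lra.
lra.
Qed.

Lemma lambda_min_quad (n : nat) (M : 'M[R]_n) x : sym_mx M ->
  lambda_min M * dotv x x <= dotv (x *m M) x.
Proof.
move=> sM; case: (posnP n) => [n0|n0].
  by rewrite !dotvE !big1 ?mulr0// => -[i i_lt]; exfalso; rewrite n0 in i_lt.
have [r er hr] := rayleigh_eigenvalue n0 sM.
apply: le_trans (hr x); rewrite ler_wpM2r ?dotvv_ge0//.
(* [r] itself bounds all eigenvalues from below, so the infimum is at most its member [r]. *)
by apply: ge_inf => //; exists r => a; exact: eigenvalue_quad.
Qed.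

Lemma lambda_min_ge0 (n : nat) (M : 'M[R]_n) : psd_mx M -> 0 <= lambda_min M.
Proof.
(* With no eigenvalue, as in dimension 0, the infimum takes its default value 0. *)
move=> pM; rewrite /lambda_min; have [->|/set0P E0] := eqVneq
  [set a | eigenvalue M a] set0; first by rewrite inf0.
by apply: lb_le_inf => // a; apply: eigenvalue_quad => x; rewrite mul0r.
Qed.

End Rayleigh.

(** * Principal submatrices and vectors supported in a set *)

Section PrincipalSubmatrices.
Set Implicit Arguments.
Unset Strict Implicit.
Variables (R : realType) (n : nat).
Implicit Types (x y b : 'rV[R]_n) (C : 'M[R]_n) (S : {set 'I_n}).

Definition supported S x := forall i, i \notin S -> x 0 i = 0.

Lemma supportedD S x y : supported S x -> supported S y -> supported S (x + y).
Proof. by move=> hx hy i iS; rewrite mxE hx ?hy ?addr0. Qed.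

Lemma supportedZ S a x : supported S x -> supported S (a *: x).
Proof. by move=> hx i iS; rewrite mxE hx ?mulr0. Qed.

Lemma supportedS S S' x : S \subset S' -> supported S x -> supported S' x.
Proof.
by move=> /fintype.subsetP sub hx i iS; apply: hx; apply: contra iS; exact: sub.
Qed.

Lemma supported_delta S i : i \in S -> supported S (delta_mx 0 i).
Proof. by move=> iS j; rewrite mxE/=; case: eqVneq => // ->; rewrite iS. Qed.

Lemma dotv_supported S x y : supported S y ->
  dotv x y = \sum_(i in S) x 0 i * y 0 i.
Proof.
move=> hy; rewrite dotvE (bigID [in S])/= [X in _ + X]big1 ?addr0// => i iS.
by rewrite hy ?mulr0.
Qed.

(** Right multiplication by this matrix extends a vector on [S] by zero; by its transpose, it
    restricts a vector to [S]. *)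
Definition select_mx S : 'M[R]_(#|S|, n) := rowsub enum_val 1%:M.

Lemma principal_submxE C S :
  principal_submx C S = select_mx S *m C *m (select_mx S)^T.
Proof.
rewrite mul_rowsub_mx mul1mx /select_mx trmx_mxsub trmx1 mulmx_colsub mulmx1.
by apply/matrixP => i j; rewrite !mxE.
Qed.

Lemma select_mxK S x : supported S x -> x *m (select_mx S)^T *m select_mx S = x.
Proof.
move=> hx; rewrite trmx_mxsub trmx1 mulmx_colsub mulmx1.
apply/rowP => j; rewrite mxE.
under eq_bigr do rewrite !mxE.
transitivity (\sum_(i in S) x 0 i * (i == j)%:R).
  by rewrite [RHS]big_enum_val.
have [jS|jS] := boolP (j \in S).
  rewrite (bigD1 j)//= eqxx mulr1 big1 ?addr0// => i /andP[_ /negbTE ->].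
  by rewrite mulr0.
rewrite hx// big1// => i iS; case: eqVneq => [ij|]; last by rewrite mulr0.
by rewrite -ij iS in jS.
Qed.

Lemma supported_select S (z : 'rV_#|S|) : supported S (z *m select_mx S).
Proof.
move=> i iS; rewrite mxE big1// => j _; rewrite !mxE; case: eqVneq => [ij|].
  by rewrite -ij enum_valP in iS.
by rewrite mulr0.
Qed.

Lemma dotv_select S x y : supported S x ->
  dotv x y = dotv (x *m (select_mx S)^T) (y *m (select_mx S)^T).
Proof.
move=> hx; rewrite -{1}(select_mxK hx) /dotv !trmx_mul trmxK mulmxA.
by congr (_ 0 0); rewrite !mulmxA.
Qed.

Lemma quad_select C S x : supported S x ->
  dotv (x *m C) x =
  dotv (x *m (select_mx S)^T *m principal_submx C S) (x *m (select_mx S)^T).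
Proof.
move=> hx; rewrite dotvC (dotv_select _ hx) dotvC; congr dotv.
by rewrite principal_submxE !mulmxA (select_mxK hx).
Qed.

Lemma sym_principal C S : sym_mx C -> sym_mx (principal_submx C S).
Proof.
by move=> sC; rewrite /sym_mx principal_submxE !trmx_mul trmxK sC mulmxA.
Qed.

Lemma psd_principal C S : psd_mx C -> psd_mx (principal_submx C S).
Proof.
move=> pC z; rewrite principal_submxE !mulmxA.
by have := pC (z *m select_mx S); rewrite /dotv trmx_mul mulmxA.
Qed.

(** The solution is [b_S C_S^-1] extended by zero, since a supported [y] only tests the coordinates
    in [S]. *)
Lemma normal_equations C b S : principal_submx C S \in unitmx ->
  exists2 x, supported S x &
    forall y, supported S y -> dotv (x *m C) y = dotv b y.
Proof.
move=> uS; pose z := b *m (select_mx S)^T *m invmx (principal_submx C S).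
exists (z *m select_mx S); first exact: supported_select.
move=> y hy; rewrite ![dotv _ y]dotvC !(dotv_select _ hy); congr dotv.
by rewrite -[RHS](mulmxKV uS) -/z principal_submxE !mulmxA.
Qed.

Lemma exists_card_superset S m : (#|S| <= m)%N -> (m <= n)%N ->
  exists2 S' : {set 'I_n}, S \subset S' & #|S'| = m.
Proof.
move=> Sm mn; have : (m - #|S| <= #|finset.setC S|)%N.
  by rewrite [leqRHS]finset.cardsCs finset.setCK card_ord leq_sub2r.
move=> /card_geqP[s [us ss sS]]; exists (S :|: [set i in s]).
  exact: finset.subsetUl.
rewrite finset.cardsU disjoint_setI0.
  by rewrite cards0 subn0 cardsE (card_uniqP us) ss subnKC.
rewrite disjoint_sym finset.disjoints_subset; apply/fintype.subsetP => i.
by rewrite inE => /sS.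
Qed.

(** Padding [S] to exactly [m] elements makes it one of the sets in the minimum; for [m > n] the
    whole matrix serves. *)
Lemma sparse_lambda_min_quad C m S x : sym_mx C -> psd_mx C ->
  (#|S| <= m)%N -> supported S x ->
  sparse_lambda_min C m * dotv x x <= dotv (x *m C) x.
Proof.
move=> sC pC Sm hx; rewrite /sparse_lambda_min; case: ifPn => mn; last first.
  exact: lambda_min_quad.
have [S' SS' S'm] := exists_card_superset Sm mn.
have hx' := supportedS SS' hx.
rewrite (quad_select C hx') (dotv_select x hx').
apply: le_trans (lambda_min_quad _ (sym_principal S' sC)).
rewrite ler_wpM2r ?dotvv_ge0//; apply: ge_inf; last by exists S'.
by exists 0 => _ [S'' _ <-]; apply: lambda_min_ge0; exact: psd_principal.
Qed.

End PrincipalSubmatrices.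

(** * Second moments of linear combinations *)

Lemma sum_option (V : zmodType) (I : finType) (F : option I -> V) :
  \sum_o F o = F None + \sum_i F (Some i).
Proof.
rewrite (bigD1 None)//=; congr (_ + _).
rewrite (reindex_omap Some id)/=; first by apply: eq_bigl => i; rewrite eqxx.
by case.
Qed.

Section SecondMoments.
Set Implicit Arguments.
Unset Strict Implicit.
Context {d : measure_display} {T : measurableType d} {R : realType}.
Variable P : probability T R.

(** The variance of a centered variable is its squared L2 norm. *)
Lemma finite_variance_Lfun2 (X : {RV P >-> R}) :
  'E_P[X]%E = 0%E -> 'V_P[X]%E = 1%E -> (X : T -> R) \in Lfun P 2%:E.
Proof.
move=> X0; rewrite /variance unlock X0/= => V1.
rewrite inE; apply/andP; split; rewrite inE//= /finite_norm unlock poweR_lty//.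
suff -> : (\int[P]_x (`|(EFin \o X) x| `^ 2) = 1)%E by rewrite ltry.
rewrite -V1 unlock; apply: eq_integral => x _ /=.
by rewrite !fctE /= subr0 powR_mulrn// real_normK ?num_real.
Qed.

Lemma centered_covariance (X Y : T -> R) :
  'E_P[X]%E = 0%E -> 'E_P[Y]%E = 0%E ->
  covariance P X Y = 'E_P[(X \* Y)%R]%E.
Proof.
move=> X0 Y0; rewrite unlock X0 Y0/=; congr expectation.
by apply/funext => t; rewrite !fctE /= !subr0.
Qed.

(** Products of square-integrable functions are integrable, so the expanded square can be integrated
    term by term. *)
Lemma expectation_sq_sum (I : finType) (Y : I -> T -> R) (w : I -> R) :
  (forall i, Y i \in Lfun P 2%:E) ->
  'E_P[fun t => ((\sum_i w i * Y i t) ^+ 2)%R]%E =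
  (\sum_i \sum_j w i * w j * fine 'E_P[(Y i \* Y j)%R]%E)%:E.
Proof.
move=> Y2.
have Y1 (p : I * I) : Y p.1 \* Y p.2 \in Lfun P 1 by exact: Lfun2_mul_Lfun1.
have iY (p : I * I) : P.-integrable setT
    (fun t => (w p.1 * w p.2)%:E * (Y p.1 t * Y p.2 t)%:E)%E.
  apply: integrableZl => //.
  exact/(Lfun1_integrable P (Y p.1 \* Y p.2)).
rewrite pair_bigA/= -sumEFin unlock.
transitivity (\int[P]_t (\sum_(p : I * I)
    (w p.1 * w p.2)%:E * (Y p.1 t * Y p.2 t)%:E))%E.
  apply: eq_integral => t _; rewrite sumEFin; congr EFin.
  rewrite expr2 big_distrlr/= pair_bigA/=.
  by apply: eq_bigr => p _; rewrite mulrACA.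
rewrite integral_sum//; apply: eq_bigr => p _.
have iYp := (Lfun1_integrable P (Y p.1 \* Y p.2)).1 (Y1 p).
by rewrite [RHS]EFinM fineK ?integrable_fin_num// -integralZl.
Qed.

End SecondMoments.

(** * [R2] as the maximum of a concave quadratic *)

Section RegressionQuadratic.
Set Implicit Arguments.
Unset Strict Implicit.
Context {d : measure_display} {T : measurableType d} {R : realType}.
Variables (P : probability T R) (n : nat).
Variables (Z : {RV P >-> R}) (X : 'I_n -> {RV P >-> R}).
Hypotheses (Z0 : 'E_P[Z]%E = 0%E) (Z1 : 'V_P[Z]%E = 1%E).
Hypotheses (X0 : forall i, 'E_P[X i]%E = 0%E).
Hypotheses (X1 : forall i, 'V_P[X i]%E = 1%E).

Let C := cov_mx X.

Definition cov_row : 'rV[R]_n := \row_i fine (covariance P Z (X i)).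

Lemma sym_cov_mx : sym_mx C.
Proof. by apply/matrixP => i j; rewrite !mxE covarianceC. Qed.

Lemma cov_mx_diag i : C i i = 1.
Proof. by rewrite mxE -/(variance P (X i)) X1. Qed.

(** The form at [x] is the second moment of [sum x_i X_i]. *)
Lemma psd_cov_mx : psd_mx C.
Proof.
move=> x; rewrite -lee_fin.
suff <- : 'E_P[fun t => ((\sum_i x 0 i * X i t) ^+ 2)%R]%E = (dotv (x *m C) x)%:E.
  by apply: expectation_ge0 => t; exact: sqr_ge0.
rewrite (expectation_sq_sum (Y := fun i => X i)) => [|i]; last first.
  exact: finite_variance_Lfun2.
congr EFin; rewrite dotvE exchange_big/=; apply: eq_bigr => j _.
rewrite mxE big_distrl/=; apply: eq_bigr => i _.
by rewrite !mxE centered_covariance// mulrAC.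
Qed.

Lemma sq_error_quad (S : {set 'I_n}) (alpha : 'I_n -> R) :
  let x := \row_i (if i \in S then alpha i else 0) in
  sq_error Z X S alpha =
  (1 - (2 * dotv cov_row x - dotv (x *m C) x))%:E.
Proof.
move=> x.
(* The residual becomes a single combination of [n + 1] variables, with [None] standing for [Z]. *)
pose Y (o : option 'I_n) : T -> R := if o is Some i then X i else Z.
pose w (o : option 'I_n) := if o is Some i then - x 0 i else 1.
have Y2 o : Y o \in Lfun P 2%:E by case: o => [i|]; exact: finite_variance_Lfun2.
rewrite /sq_error.
transitivity ('E_P[fun t => ((\sum_o w o * Y o t) ^+ 2)%R])%E.
  congr expectation; apply/funext => t; congr (_ ^+ 2).
  rewrite sum_option/= mul1r; congr (_ + _).
  rewrite big_mkcond/= -sumrN; apply: eq_bigr => i _.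
  by rewrite mxE; case: ifPn; rewrite mulNr ?mul0r.
rewrite expectation_sq_sum//; congr EFin.
rewrite sum_option/=; under [X in _ + X]eq_bigr do rewrite sum_option/=.
rewrite sum_option/= big_split/=.
have -> : fine 'E_P[(Z \* Z)%R]%E = 1.
  by rewrite -centered_covariance// -/(variance P Z) Z1.
have -> : \sum_i 1 * - x 0 i * fine 'E_P[(Z \* X i)%R]%E = - dotv cov_row x.
  rewrite dotvE -sumrN; apply: eq_bigr => i _.
  by rewrite [cov_row _ _]mxE centered_covariance// mul1r mulNr mulrC.
have -> : \sum_i - x 0 i * 1 * fine 'E_P[(X i \* Z)%R]%E = - dotv cov_row x.
  rewrite dotvE -sumrN; apply: eq_bigr => i _.
  by rewrite [cov_row _ _]mxE covarianceC centered_covariance// mulr1 mulNr mulrC.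
have -> : \sum_i \sum_j - x 0 i * - x 0 j * fine 'E_P[(X i \* X j)%R]%E =
    dotv (x *m C) x.
  rewrite dotvE exchange_big/=; apply: eq_bigr => j _.
  rewrite [(_ *m _) _ _]mxE big_distrl/=; apply: eq_bigr => i _.
  by rewrite [C _ _]mxE centered_covariance// mulrNN mulrAC.
ring.
Qed.

(** Here [x] is the least squares solution, and the last clause completes the square around it. *)
Lemma R2_quadP (S : {set 'I_n}) : principal_submx C S \in unitmx ->
  exists x, [/\ supported S x,
    (forall i, i \in S -> (x *m C) 0 i = cov_row 0 i),
    R2 Z X S = 2 * dotv cov_row x - dotv (x *m C) x &
    forall y, supported S y ->
      2 * dotv cov_row y - dotv (y *m C) y =
      R2 Z X S - dotv ((y - x) *m C) (y - x)].
Proof.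
move=> uS; have [x sx hx] := normal_equations cov_row uS.
have qy y : supported S y -> 2 * dotv cov_row y - dotv (y *m C) y =
    2 * dotv cov_row x - dotv (x *m C) x - dotv ((y - x) *m C) (y - x).
  move=> sy; have := dotv_sqD y x (-1) sym_cov_mx; rewrite scaleN1r => ->.
  rewrite -!hx// (dotv_symC x y sym_cov_mx); ring.
have R2x : R2 Z X S = 2 * dotv cov_row x - dotv (x *m C) x.
  rewrite /R2.
  suff -> : ereal_inf [set sq_error Z X S alpha | alpha in [set: 'I_n -> R]] =
     (1 - (2 * dotv cov_row x - dotv (x *m C) x))%:E by rewrite /=; ring.
  apply/eqP; rewrite eq_le; apply/andP; split.
    apply: ereal_inf_lbound; exists (x 0) => //; rewrite sq_error_quad.
    suff -> : (\row_i (if i \in S then x 0 i else 0)) = x by [].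
    by apply/rowP => i; rewrite mxE; case: ifPn => // iS; rewrite sx.
  apply: le_ereal_inf_tmp => _ [alpha _ <-].
  rewrite sq_error_quad lee_fin lerD2l lerN2.
  rewrite qy; last by move=> i /negbTE iS; rewrite mxE iS.
  by rewrite lerBlDr lerDl; exact: psd_cov_mx.
exists x; split => // [i iS|y sy].
  by rewrite -!dotv_delta hx//; exact: supported_delta.
by rewrite qy// R2x.
Qed.

End RegressionQuadratic.

(** * Exponential estimates for powers *)

Section HalvingEstimates.
Set Implicit Arguments.
Unset Strict Implicit.
Variable R : realType.
Implicit Types a t u : R.

(** This is [ln u <= u - 1], scaled by [a] and exponentiated. *)
Lemma powR_le_expR u a : 0 < u -> 0 <= a -> u `^ a <= expR (a * (u - 1)).
Proof.
move=> u0 a0; rewrite /powR gt_eqF// ler_expR ler_wpM2l//.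
have := @le_ln1Dx R (u - 1); rewrite [1 + _]addrC subrK; apply.
by rewrite ltrBrDr addNr.
Qed.

(** The power is at most [e^(-a/(t-a)) <= 1 / (1 + a/(t-a))], which equals [1 - a/t]. *)
Lemma shifted_ratio_powR t a : 0 <= a -> 0 < t - 1 - a ->
  ((t - 1 - a) / (t - a)) `^ a <= 1 - a / t.
Proof.
move=> a0 ta; have ta1 : 0 < t - a by lra.
have t0 : 0 < t by lra.
apply: le_trans (powR_le_expR _ a0) _; first exact: divr_gt0.
have -> : a * ((t - 1 - a) / (t - a) - 1) = - (a / (t - a)) by field; lra.
have -> : 1 - a / t = (1 + a / (t - a))^-1 by field; apply/andP; split; lra.
rewrite expRN lef_pV2 ?posrE ?expR_gt0 ?expR_ge1Dx//.
by rewrite ltr_wpDr// divr_ge0// ltW.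
Qed.

(** Since [2^-a <= (e^(a/4))^-2] and [e^(a/4) >= 1 + a/4 >= (1 + a)/4], the product is at most
    [8 * 16]. *)
Lemma half_powR_le a : 0 <= a -> (2^-1) `^ a * (8 * (1 + a) ^+ 2) <= 128.
Proof.
move=> a0; have h := @powR_le_expR 2^-1 a ltac:(lra) a0.
have e0 := expR_gt0 (a / 4).
have hE : expR (a * (2^-1 - 1)) = (expR (a / 4) ^+ 2)^-1.
  by rewrite -expRM_natl -expRN; congr expR; field.
have e1 := expR_ge1Dx (a / 4).
rewrite hE in h.
apply: (@le_trans _ _ ((expR (a / 4) ^+ 2)^-1 * (8 * (1 + a) ^+ 2))).
  by rewrite ler_wpM2r// mulr_ge0// sqr_ge0.
by rewrite mulrC ler_pdivrMr ?exprn_gt0//; nra.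
Qed.

(** One half is the ratio times a correction factor; as [a (1 + a) <= j - a], the [a]-th power of
    that factor is at most [e^(1/2) <= 2]. *)
Lemma half_powR_le_ratio (j k : nat) a : 0 <= a -> 8 * (1 + a) ^+ 2 <= k%:R ->
  (k <= j.*2.+1)%N ->
  (2^-1) `^ a <= 2 * ((j%:R - a) / (k%:R - a)) `^ a.
Proof.
move=> a0 hk; rewrite -(ler_nat R) -addn1 natrD -muln2 natrM => kj.
move: (j%:R) (k%:R) hk kj => y x hx xy.
have ya : a * (1 + a) <= y - a by nra.
have ya0 : 0 < y - a by nra.
have xa0 : 0 < x - a by nra.
have -> : 2^-1 = (y - a) / (x - a) * ((x - a) / (2 * (y - a))).
  by field; apply/andP; split; lra.
rewrite powRM; [|by rewrite ltW// divr_gt0|by rewrite ltW// divr_gt0// mulr_gt0].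
rewrite mulrC ler_wpM2r ?powR_ge0//.
apply: le_trans (powR_le_expR _ a0) _; first by rewrite divr_gt0// mulr_gt0.
apply: (@le_trans _ _ (expR 2^-1)).
  rewrite ler_expR.
  have -> : a * ((x - a) / (2 * (y - a)) - 1) = a * (x + a - 2 * y) / (2 * (y - a)).
    by field; lra.
  by rewrite ler_pdivrMr; nra.
rewrite -[2^-1]opprK expRN -[leRHS]invrK lef_pV2 ?posrE ?expR_gt0//.
by apply: le_trans (expR_ge1Dx _); lra.
Qed.

End HalvingEstimates.

(** * Averages and unions over finite sets *)

Section FiniteSets.
Set Implicit Arguments.
Unset Strict Implicit.

Lemma exists_le_mean (R : realType) (T : finType) (A : {set T}) (F : T -> R) :
  (0 < #|A|)%N ->
  exists2 i, i \in A & #|A|%:R * F i <= \sum_(i in A) F i.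
Proof.
move=> /card_gt0P[i0 i0A]; case: (arg_minP F i0A) => i iA hi.
by exists i => //; rewrite mulr_natl -sumr_const; apply: ler_sum.
Qed.

Lemma setDUK (T : finType) (A B : {set T}) : (A :\: B) :|: B = A :|: B.
Proof. by apply/finset.setP => x; rewrite !inE; case: (x \in B); rewrite ?orbT. Qed.

End FiniteSets.

(** * Gains of a set function defined by a quadratic maximum *)

Section QuadraticSetFunction.
Set Implicit Arguments.
Unset Strict Implicit.
Variables (R : realType) (n : nat) (C : 'M[R]_n) (b : 'rV[R]_n).
Variable f : {set 'I_n} -> R.
Implicit Types S L : {set 'I_n}.
Hypotheses (sC : sym_mx C) (pC : psd_mx C) (C1 : forall i, C i i = 1).
(** Abstract form of [R2_quadP], through which alone [f] is known in this section. *)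
Hypothesis fP : forall S, exists x, [/\ supported S x,
    (forall i, i \in S -> (x *m C) 0 i = b 0 i),
    f S = 2 * dotv b x - dotv (x *m C) x &
    forall y, supported S y ->
      2 * dotv b y - dotv (y *m C) y = f S - dotv ((y - x) *m C) (y - x)].

Lemma quad_le S y : supported S y -> 2 * dotv b y - dotv (y *m C) y <= f S.
Proof.
by have [x [_ _ _ h]] := fP S => /h ->; rewrite lerBlDr lerDl; exact: pC.
Qed.

Lemma quad_mono S L : S \subset L -> f S <= f L.
Proof.
by move=> SL; have [x [sx _ -> _]] := fP S; apply: quad_le; exact: supportedS sx.
Qed.

Lemma quad_set0 : f finset.set0 = 0.
Proof.
have [x [sx _ -> _]] := fP finset.set0.
have -> : x = 0 by apply/rowP => i; rewrite mxE sx// inE.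
by rewrite mul0mx dotvC /dotv !mul0mx !mxE mulr0 subrr.
Qed.

Lemma quad_ge0 S : 0 <= f S.
Proof. by rewrite -quad_set0 quad_mono// finset.sub0set. Qed.

(** The form in which sparse eigenvalues enter the greedy analysis. *)
Definition coercive_on (lam : R) S :=
  forall x, supported S x -> lam * dotv x x <= dotv (x *m C) x.

Lemma delta_mulmx_diag i : ((delta_mx 0 i : 'rV_n) *m C) 0 i = 1.
Proof. by rewrite -rowE mxE C1. Qed.

(** Moving by [r] along coordinate [i] changes the quadratic by [2 r^2 - r^2 C_ii = r^2]. *)
Lemma gain_ge_sqr L x i : supported L x ->
  f L = 2 * dotv b x - dotv (x *m C) x ->
  (b 0 i - (x *m C) 0 i) ^+ 2 <= f (i |: L) - f L.
Proof.
move=> sx ->; set r := b 0 i - _.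
have sy : supported (i |: L) (x + r *: delta_mx 0 i).
  apply: supportedD; first exact: supportedS (finset.subsetUr _ _) sx.
  by apply: supportedZ; apply: supported_delta; rewrite finset.setU11.
have := quad_le sy; rewrite dotv_sqD// dotvDr dotvZr !dotv_delta.
by rewrite delta_mulmx_diag /r; lra.
Qed.

(* With r = b - x C the residual of the regression on L, and d the change of
   the optimal coefficients from L to S :|: L, the total gain is
   2 r.d - dCd <= sum over S of (2 r_i d_i - lam d_i^2), while adding i alone
   gains at least r_i^2. *)
Lemma joint_gain_le_sum lam S L : S :&: L = finset.set0 ->
  coercive_on lam (S :|: L) ->
  lam * (f (S :|: L) - f L) <= \sum_(i in S) (f (i |: L) - f L).
Proof.
move=> SL0 hlam; have [x [sx nx fL _]] := fP L.
have [y [sy _ fT _]] := fP (S :|: L).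
pose r := b - x *m C; pose e := y - x.
have rE i : r 0 i = b 0 i - (x *m C) 0 i by rewrite mxE [X in _ + X]mxE.
have re : y = x + 1 *: e by rewrite scale1r addrC subrK.
have se : supported (S :|: L) e.
  rewrite /e -scaleN1r; apply: supportedD => //; apply: supportedZ.
  exact: supportedS (finset.subsetUr _ _) sx.
have gap : f (S :|: L) - f L = 2 * dotv r e - dotv (e *m C) e.
  rewrite fT fL {1 2 3}re dotv_sqD// dotvDr dotvZr /r dotvDl dotvNl; ring.
(* The normal equations make [r] vanish on [L], and [e] vanishes outside [S :|: L]. *)
have dre : dotv r e = \sum_(i in S) r 0 i * e 0 i.
  rewrite dotvE (bigID [in S])/= [X in _ + X]big1 ?addr0// => i iS.
  have [iL|iL] := boolP (i \in L); first by rewrite rE nx// subrr mul0r.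
  by rewrite se ?mulr0// inE negb_or iS.
have eeS : \sum_(i in S) e 0 i ^+ 2 <= dotv e e.
  rewrite dotvE [leRHS](bigID [in S])/=.
  under [leLHS]eq_bigr do rewrite expr2.
  rewrite lerDl.
  by apply: sumr_ge0 => i _; rewrite -expr2 sqr_ge0.
have gain i : r 0 i ^+ 2 <= f (i |: L) - f L.
  by rewrite rE; exact: gain_ge_sqr.
have [lam0|lam0] := lerP lam 0.
  rewrite (@le_trans _ _ 0)//; last first.
    by apply: sumr_ge0 => i _; apply: le_trans (gain i); rewrite sqr_ge0.
  by rewrite mulr_le0_ge0// subr_ge0 quad_mono// finset.subsetUr.
apply: (@le_trans _ _ (\sum_(i in S) r 0 i ^+ 2)); last exact: ler_sum.
have hS : f (S :|: L) - f L <= \sum_(i in S) (2 * (r 0 i * e 0 i) - lam * e 0 i ^+ 2).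
  rewrite gap dre sumrB -!mulr_sumr lerD2l lerN2 (le_trans _ (hlam _ se))//.
  by rewrite ler_pM2l.
apply: (le_trans (ler_wpM2l (ltW lam0) hS)); rewrite mulr_sumr ler_sum// => i _.
(* Expanding this square gives [2 lam r e - lam^2 e^2 <= r^2]. *)
by have := sqr_ge0 (r 0 i - lam * e 0 i); nra.
Qed.

(** Zeroing the smallest coefficient [x_i] costs [C_ii x_i^2 = x_i^2], and [x_i^2 <= |x|^2 / #|S| <=
    f S / (lam #|S|)]. *)
Lemma exists_removal lam S : 0 < lam -> (0 < #|S|)%N -> coercive_on lam S ->
  exists2 i, i \in S & f S * (1 - (lam * #|S|%:R)^-1) <= f (S :\ i).
Proof.
move=> lam0 S0 hlam; have [x [sx nx fS qx]] := fP S.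
have [i iS hi] := exists_le_mean (fun i => x 0 i ^+ 2) S0; exists i => //.
have fSx : f S = dotv (x *m C) x.
  have : dotv b x = dotv (x *m C) x.
    by rewrite !(dotv_supported _ sx); apply: eq_bigr => j jS; rewrite nx.
  by rewrite fS => ->; ring.
have hx : lam * (#|S|%:R * x 0 i ^+ 2) <= f S.
  rewrite fSx (le_trans _ (hlam _ sx))// ler_pM2l// (le_trans hi)//.
  by rewrite (dotv_supported _ sx) ler_sum// => j _; rewrite expr2.
pose y := x + (- x 0 i) *: delta_mx 0 i.
have sy : supported (S :\ i) y.
  move=> j; rewrite !inE negb_and negbK => /orP[/eqP ->|jS].
    by rewrite /y !mxE !eqxx/= mulr1 subrr.
  have /negbTE ji : j != i by apply: contraNneq jS => ->.
  by rewrite /y !mxE (sx j jS) ji andbF mulr0 addr0.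
have := quad_le sy; rewrite qx; last exact: supportedS (subD1set _ _) sy.
rewrite [y - x](_ : _ = - x 0 i *: delta_mx 0 i); last by rewrite addrC addKr.
rewrite -scalemxAl dotvZl dotvZr dotv_delta delta_mulmx_diag => /(le_trans _); apply.
rewrite mulrBr !mulr1 lerD2l lerN2 mulrNN ler_pdivlMr ?mulr_gt0 ?ltr0n//.
by apply: le_trans hx; rewrite [leLHS](_ : _ = lam * (#|S|%:R * x 0 i ^+ 2))//; ring.
Qed.

(** * Greedy selection against a fixed competitor *)

Definition greedy_step S S' :=
  exists m, (forall m', f (m' |: S) <= f (m |: S)) /\ S' = m |: S.

(** The best single gain is at least the average over the at most [k] variables of [S :\: S0]. *)
Lemma greedy_step_gain g k S0 S1 S : 0 <= g -> (0 < k)%N -> (#|S| <= k)%N ->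
  greedy_step S0 S1 ->
  g * (f (S :|: S0) - f S0) <= \sum_(m in S :\: S0) (f (m |: S0) - f S0) ->
  g / k%:R * (f S - f S0) <= f S1 - f S0.
Proof.
move=> g0 k0 Sk [m [hm ->]] hg.
rewrite mulrAC ler_pdivrMr ?ltr0n//.
apply: (@le_trans _ _ (g * (f (S :|: S0) - f S0))).
  by rewrite ler_wpM2l// lerD2r quad_mono// finset.subsetUl.
apply: (le_trans hg).
apply: (@le_trans _ _ (\sum_(i in S :\: S0) (f (m |: S0) - f S0))).
  by apply: ler_sum => i _; rewrite lerD2r.
rewrite sumr_const -[leLHS]mulr_natr ler_wpM2l//.
  by rewrite subr_ge0 quad_mono// finset.subsetUr.
by rewrite ler_nat (leq_trans _ Sk)// subset_leq_card// finset.subsetDl.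
Qed.

(** Each step shrinks the gap to [f S] by the factor [1 - g/k], and [(1 - g/k)^k <= e^(-g)]. *)
Lemma greedy_approx g k (s : nat -> {set 'I_n}) S : g <= 1 -> (0 < k)%N ->
  (#|S| <= k)%N -> s 0%N = finset.set0 ->
  (forall i, (i < k)%N -> greedy_step (s i) (s i.+1)) ->
  (forall i, (i < k)%N -> g * (f (S :|: s i) - f (s i)) <=
     \sum_(m in S :\: s i) (f (m |: s i) - f (s i))) ->
  (1 - expR (- g)) * f S <= f (s k).
Proof.
move=> g1 k0 Sk s0 step hg; have [g0|g0] := ltrP g 0.
  rewrite (@le_trans _ _ 0) ?quad_ge0// mulr_le0_ge0 ?quad_ge0//.
  by rewrite subr_le0 (le_trans _ (expR_ge1Dx _))// lerDl oppr_ge0 ltW.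
have kR : 0 < k%:R :> R by rewrite ltr0n.
(* A nonnegative factor is needed to multiply the inductive inequality by it. *)
have gk : 0 <= 1 - g / k%:R.
  by rewrite subr_ge0 ler_pdivrMr// mul1r (le_trans g1)// ler1n.
have chain i : (i <= k)%N -> f S - f (s i) <= (1 - g / k%:R) ^+ i * f S.
  elim: i => [_|i IH ik]; first by rewrite s0 quad_set0 subr0 mul1r.
  have := greedy_step_gain g0 k0 Sk (step i ik) (hg i ik).
  have := ler_wpM2l gk (IH (ltnW ik)); rewrite exprS -mulrA; lra.
have : (1 - g / k%:R) ^+ k <= expR (- g).
  have -> : - g = k%:R * - (g / k%:R) by rewrite mulrN mulrC divfK ?gt_eqF.
  rewrite expRM_natl lerXn2r ?nnegrE ?expR_ge0//.
  exact: expR_ge1Dx.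
move=> /(ler_wpM2r (quad_ge0 S)); have := chain k (leqnn k); lra.
Qed.

Lemma coercive_onS lam S L : S \subset L -> coercive_on lam L ->
  coercive_on lam S.
Proof. by move=> SL h x /(supportedS SL)/h. Qed.

(** Test the form on a unit vector, where it equals [C_ii = 1]. *)
Lemma coercive_on_le1 lam S : (0 < #|S|)%N -> coercive_on lam S -> lam <= 1.
Proof.
move=> /card_gt0P[i iS] h; have := h _ (supported_delta R iS).
by rewrite !dotv_delta delta_mulmx_diag mxE !eqxx mulr1.
Qed.

(* Removing the variable of least coefficient from a set of size t multiplies
   f by at least 1 - a / t >= ((t - 1 - a) / (t - a))^a, a telescoping
   factor. *)
Lemma small_subset_value (lam : R) S i : 0 < lam -> coercive_on lam S ->
  (i <= #|S|)%N -> lam^-1 < i%:R ->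
  exists2 S' : {set 'I_n}, #|S'| = i &
    ((i%:R - lam^-1) / (#|S|%:R - lam^-1)) `^ (lam^-1) * f S <= f S'.
Proof.
move=> lam0 hS; set a := lam^-1; have a0 : 0 <= a by rewrite invr_ge0 ltW.
(* Induction on the number [d] of removed variables; keeping [S' \subset S] preserves coercivity. *)
suff H d : (d <= #|S|)%N -> a < (#|S| - d)%:R ->
    exists S' : {set 'I_n}, [/\ S' \subset S, #|S'| = (#|S| - d)%N &
      (((#|S| - d)%:R - a) / (#|S|%:R - a)) `^ a * f S <= f S'].
  move=> iS ai; have [||S' [_ S'i]] := H (#|S| - i)%N; rewrite ?leq_subr ?subKn//.
  by exists S'; rewrite // S'i subKn.
elim: d => [_|d IH dS] aS.
  exists S; split; rewrite ?subn0// divff ?powR1 ?mul1r//.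
  by rewrite subr_eq0 gt_eqF//; move: aS; rewrite subn0.
have tE : (#|S| - d = (#|S| - d.+1).+1)%N by rewrite subnS prednK// subn_gt0.
move: aS IH; rewrite tE; set t := (#|S| - d.+1)%N => aS IH.
have [||S' [S'S S't hS']] := IH; first exact: ltnW.
  by rewrite (lt_le_trans aS)// ler_nat.
have S'0 : (0 < #|S'|)%N by rewrite S't.
have [j jS' hj] := exists_removal lam0 S'0 (coercive_onS S'S hS).
exists (S' :\ j); split.
- exact: fintype.subset_trans (subD1set _ _) S'S.
- by have := cardsD1 j S'; rewrite jS' S't => -[].
apply: le_trans hj; rewrite S't invfM -/a.
have Sa : 0 < #|S|%:R - a.
  by rewrite subr_gt0 (lt_le_trans aS)// ler_nat leq_subr.
have taE : t%:R - a = t.+1%:R - 1 - a by rewrite -addn1 natrD addrK.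
have ta0 : 0 < t%:R - a by rewrite subr_gt0.
have ta1 : 0 < t.+1%:R - a by lra.
have -> : (t%:R - a) / (#|S|%:R - a) =
    (t.+1%:R - a) / (#|S|%:R - a) * ((t%:R - a) / (t.+1%:R - a)).
  by rewrite [RHS]mulrC mulrA divfK ?gt_eqF.
rewrite powRM ?divr_ge0 ?(ltW ta0) ?(ltW ta1) ?(ltW Sa)// mulrAC.
rewrite ler_pM ?mulr_ge0 ?powR_ge0 ?quad_ge0//.
by rewrite taE shifted_ratio_powR// -taE.
Qed.

(* If k < 8 (1 + a)^2, the first greedy step already gives (lam / k) f S, which
   is at least of the order of lam 2^-a. Otherwise the first k/2 greedy steps
   compete with a subset of S of size k/2. *)
Lemma greedy_approx_half lam k (s : nat -> {set 'I_n}) S : (0 < k)%N ->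
  #|S| = k -> (forall L, (#|L| <= k)%N -> coercive_on lam L) ->
  s 0%N = finset.set0 ->
  (forall i, (i < k)%N -> greedy_step (s i) (s i.+1)) ->
  (1 - expR (- lam)) * (128^-1 * (2^-1) `^ (lam^-1)) * f S <= f (s k).
Proof.
move=> k0 Sk hlam s0 step.
have f0 L : 0 <= f L := quad_ge0 L.
have fS := quad_mono.
have lam1 : lam <= 1 by apply: (coercive_on_le1 _ (hlam S _)); rewrite Sk.
have p0 : 0 <= (2^-1 : R) `^ (lam^-1) := powR_ge0 _ _.
have [lam0|lam0] := lerP lam 0.
  rewrite (le_trans _ (f0 _))// mulr_le0_ge0// mulr_le0_ge0 ?mulr_ge0//.
  by rewrite subr_le0 (le_trans _ (expR_ge1Dx _))// lerDl oppr_ge0.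
have explam : 1 - expR (- lam) <= lam by have := expR_ge1Dx (- lam); lra.
have explam0 : 0 <= 1 - expR (- lam) by rewrite subr_ge0 -expR0 ler_expR oppr_le0 ltW.
have card_s i : (i <= k)%N -> (#|s i| <= i)%N.
  elim: i => [_|i IH ik]; first by rewrite s0 cards0.
  have [m [_ ->]] := step i ik.
  by rewrite cardsU1 -add1n leq_add ?leq_b1 ?IH 1?ltnW.
have mono_s i j : (i <= j)%N -> (j <= k)%N -> f (s i) <= f (s j).
  move=> ij; elim: j ij => [|j IH]; first by rewrite leqn0 => /eqP ->.
  rewrite leq_eqVlt => /predU1P[->//|ij] jk; apply: (le_trans (IH ij (ltnW jk))).
  by have [m [_ ->]] := step j jk; apply/fS/finset.subsetUr.
set a := lam^-1 in p0 *; have a0 : 0 <= a by rewrite invr_ge0 ltW.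
have kR : 0 < k%:R :> R by rewrite ltr0n.
(* The size condition keeps [L :|: s i] within [k] elements, where [lam] controls the form. *)
have gain i L : (#|L| + i <= k)%N -> lam * (f (L :|: s i) - f (s i)) <=
    \sum_(m in L :\: s i) (f (m |: s i) - f (s i)).
  move=> Lik; rewrite -setDUK; apply: joint_gain_le_sum.
    by apply/finset.setP => x; rewrite !inE; case: (x \in s i); rewrite ?andbF.
  rewrite setDUK; apply: hlam; apply: (leq_trans _ Lik).
  rewrite (leq_trans (leq_card_setU _ _))// leq_add2l card_s//.
  exact: leq_trans (leq_addl _ _) Lik.
have [hk|hk] := ltrP k%:R (8 * (1 + a) ^+ 2).
  have h1 : lam / k%:R * f S <= f (s 1%N).
    have := greedy_step_gain (ltW lam0) k0 (eq_leq Sk) (step 0%N k0).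
    move=> /(_ (gain 0%N S _)); rewrite addn0 s0 quad_set0 !subr0; apply.
    exact: eq_leq.
  apply: le_trans (mono_s 1%N k k0 (leqnn _)); apply: le_trans h1.
  rewrite ler_wpM2r// ler_pM ?mulr_ge0//.
  rewrite -[leRHS]mul1r ler_pdivlMr//.
  (* Here [k 2^-a <= 8 (1 + a)^2 2^-a <= 128], the source of the constant. *)
  by have := half_powR_le a0; have := ler_wpM2l p0 (ltW hk); lra.
have kj : (k <= k./2.*2.+1)%N by lia.
have jk : (k./2.*2 <= k)%N by lia.
have aj : a < k./2%:R.
  by move: kj; rewrite -(ler_nat R) -addn1 natrD -muln2 natrM; nra.
have j0 : (0 < k./2)%N by rewrite -(ltr_nat R) (le_lt_trans a0).
have [|||S' S'j hS'] := @small_subset_value lam S k./2 lam0.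
- by apply: hlam; rewrite Sk.
- by rewrite Sk; lia.
- by [].
apply: (@le_trans _ _ ((1 - expR (- lam)) * f S')).
  rewrite -mulrA ler_wpM2l//; apply: le_trans hS'; rewrite ler_wpM2r//.
  (* The factor 2 lost in halving is absorbed by [128^-1]. *)
  have := half_powR_le_ratio a0 hk kj; rewrite Sk -/a.
  by have := powR_ge0 ((k./2%:R - a) / (k%:R - a)) a; lra.
apply: le_trans (mono_s k./2 k _ _); rewrite ?leqnn//; last by lia.
apply: greedy_approx => // [|i ij|i ij]; first by rewrite S'j.
- by apply: step; lia.
- by apply: gain; rewrite S'j; lia.
Qed.

End QuadraticSetFunction.

(** * Forward Regression, the optimum and the submodularity ratio *)

Section ForwardRegression.
Set Implicit Arguments.
Unset Strict Implicit.
Context {d : measure_display} {T : measurableType d} {R : realType}.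
Variables (P : probability T R) (n : nat).
Variables (Z : {RV P >-> R}) (X : 'I_n -> {RV P >-> R}).
Hypotheses (Z0 : 'E_P[Z]%E = 0%E) (Z1 : 'V_P[Z]%E = 1%E).
Hypotheses (X0 : forall i, 'E_P[X i]%E = 0%E).
Hypotheses (X1 : forall i, 'V_P[X i]%E = 1%E).
Hypothesis uC : forall S : {set 'I_n}, principal_submx (cov_mx X) S \in unitmx.

Let C := cov_mx X.
Let f := R2 Z X.
Let sC : sym_mx C := sym_cov_mx X.
Let pC : psd_mx C := psd_cov_mx X0 X1.
Let C1 := cov_mx_diag X1.
Let fP S := R2_quadP Z0 Z1 X0 X1 (uC S).

Lemma sparse_coercive m (L : {set 'I_n}) : (#|L| <= m)%N ->
  coercive_on C (sparse_lambda_min C m) L.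
Proof. by move=> Lm x xL; exact: sparse_lambda_min_quad Lm xL. Qed.

Lemma OPT_attained k : (k <= n)%N ->
  exists2 S : {set 'I_n}, #|S| = k & OPT Z X k = f S.
Proof.
move=> kn; have [|S0 _ /eqP S0k] := @exists_card_superset n finset.set0 k _ kn.
  by rewrite cards0.
case: (@arg_maxP _ _ _ S0 [pred S : {set 'I_n} | #|S| == k] f S0k).
move=> S /eqP Sk hS; exists S => //.
have ubS : ubound [set f S' | S' in [set S' : {set 'I_n} | #|S'| = k]] (f S).
  by move=> _ [S' /eqP S'k <-]; exact: hS.
apply/eqP; rewrite eq_le; apply/andP; split.
  by apply: ge_sup => //; exists (f S), S.
by apply: ub_le_sup; [exists (f S)|exists S].
Qed.

(** Inclusion in [SFR] makes each intermediate set an admissible [L] in the ratio for [U = SFR]. *)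
Lemma forward_regression_greedy k SFR : forward_regression Z X k SFR ->
  exists s : nat -> {set 'I_n}, [/\ s 0%N = finset.set0,
    forall i, (i < k)%N -> greedy_step f (s i) (s i.+1),
    s k = SFR & forall i, (i <= k)%N -> s i \subset SFR /\ (#|s i| <= i)%N].
Proof.
move=> [s [s0 step sk]]; exists s; split => //.
  by move=> i /step[m [_ hm ->]]; exists m.
move=> i ik; split.
  rewrite -sk; move: ik; elim: k step {sk} => [|k IH] step.
    by rewrite leqn0 => /eqP ->.
  rewrite leq_eqVlt => /predU1P[->//|ik].
  have [m [_ _ ->]] := step k (leqnn _).
  apply: fintype.subset_trans (finset.subsetUr _ _); apply: IH => // j jk.
  exact/step/ltnW.
elim: i ik => [|i IH] ik; first by rewrite s0 cards0.
have [m [_ _ ->]] := step i ik.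
by rewrite cardsU1 -add1n leq_add ?leq_b1 ?IH 1?ltnW.
Qed.

Let ratio_set (U : {set 'I_n}) k := [set x : R | exists L S : {set 'I_n},
  [/\ L \subset U, (#|S| <= k)%N, S :&: L = finset.set0 &
      x = quot01 (\sum_(i in S) (f (i |: L) - f L)) (f (S :|: L) - f L)]].

(** Two empty sets give [0/0], which counts as 1. *)
Lemma ratio_set1 U k : ratio_set U k 1.
Proof.
exists finset.set0, finset.set0; split; rewrite ?finset.sub0set ?cards0//.
  by rewrite finset.setI0.
by rewrite big_set0 finset.setU0 subrr /quot01 eqxx.
Qed.

Lemma gains_ge0 (L S : {set 'I_n}) : 0 <= \sum_(i in S) (f (i |: L) - f L).
Proof.
by apply: sumr_ge0 => i _; rewrite subr_ge0 (quad_mono pC fP)// finset.subsetUr.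
Qed.

Lemma joint_gain_ge0 (L S : {set 'I_n}) : 0 <= f (S :|: L) - f L.
Proof. by rewrite subr_ge0 (quad_mono pC fP)// finset.subsetUr. Qed.

Lemma ratio_set_ge0 U k : lbound (ratio_set U k) 0.
Proof.
move=> _ [L [S [_ _ _ ->]]]; rewrite /quot01; case: ifP => // _.
by rewrite divr_ge0 ?gains_ge0 ?joint_gain_ge0.
Qed.

Lemma submodularity_ratio_le1 U k : submodularity_ratio Z X U k <= 1.
Proof.
by apply: ge_inf; [exists 0; exact: ratio_set_ge0|exact: ratio_set1].
Qed.

Lemma submodularity_ratioP k (U L S : {set 'I_n}) :
  L \subset U -> (#|S| <= k)%N -> S :&: L = finset.set0 ->
  submodularity_ratio Z X U k * (f (S :|: L) - f L) <=
  \sum_(i in S) (f (i |: L) - f L).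
Proof.
move=> LU Sk SL; have := joint_gain_ge0 L S; rewrite le_eqVlt => /predU1P[<-|b0].
  by rewrite mulr0 gains_ge0.
rewrite -ler_pdivlMr//; apply: ge_inf; first by exists 0; exact: ratio_set_ge0.
by exists L, S; split; rewrite // /quot01 (gt_eqF b0) andbF.
Qed.

(** Each [S :|: L] has at most [m] elements, so [joint_gain_le_sum] bounds every quotient; the value
    1 of [0/0] is covered by the unit diagonal. *)
Lemma sparse_lambda_le_ratio (U : {set 'I_n}) k m : (0 < n)%N -> (0 < m)%N ->
  (#|U| + k <= m)%N ->
  sparse_lambda_min C m <= submodularity_ratio Z X U k.
Proof.
move=> n0 m0 Ukm; apply: lb_le_inf; first by exists 1; exact: ratio_set1.
have lam1 : sparse_lambda_min C m <= 1.
  apply: (@coercive_on_le1 _ _ _ C1 _ (finset.set1 (Ordinal n0))).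
    by rewrite cards1.
  by apply: sparse_coercive; rewrite cards1.
move=> _ [L [S [LU Sk SL ->]]].
have hT : coercive_on C (sparse_lambda_min C m) (S :|: L).
  apply: sparse_coercive; rewrite (leq_trans (leq_card_setU _ _))//.
  by rewrite addnC (leq_trans _ Ukm)// leq_add ?subset_leq_card.
have := joint_gain_le_sum sC pC C1 fP SL hT; rewrite -/f.
have [b0 _|b0] := eqVneq (f (S :|: L) - f L) 0; last first.
  have bgt0 : 0 < f (S :|: L) - f L by rewrite lt_def b0 joint_gain_ge0.
  by rewrite /quot01 (negbTE b0) andbF ler_pdivlMr.
(* By monotonicity a zero joint gain forces zero single gains, so the quotient is the conventional
   1. *)
suff -> : \sum_(i in S) (f (i |: L) - f L) = 0 by rewrite /quot01 b0 eqxx.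
apply: big1 => i iS; apply/eqP.
rewrite eq_le subr_ge0 (quad_mono pC fP) ?finset.subsetUr// andbT -b0 lerD2r.
by rewrite (quad_mono pC fP)// finset.setSU// finset.sub1set.
Qed.

End ForwardRegression.

(* [theta] depends on no parameter of the problem: the constants hidden in
   Theta((1/2)^(1/lambda)) are absolute, for all sparse eigenvalues lambda in
   ]0, 1], which is where they lie since C has unit diagonal. *)
Theorem theorem3p2 (R : realType) :
  exists theta : R -> R,
    Theta_on [set x : R | 0 < x <= 1] (fun x => (2^-1) `^ (x^-1)) theta /\
    forall (d : measure_display) (T : measurableType d) (P : probability T R)
      (n k : nat) (Z : {RV P >-> R}) (X : 'I_n -> {RV P >-> R})
      (SFR : {set 'I_n}),
      (0 < k)%N -> (k <= n)%N ->
      'E_P[Z]%E = 0%E -> 'V_P[Z]%E = 1%E ->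
      (forall i, 'E_P[X i]%E = 0%E) -> (forall i, 'V_P[X i]%E = 1%E) ->
      (forall S : {set 'I_n}, principal_submx (cov_mx X) S \in unitmx) ->
      forward_regression Z X k SFR ->
      let gamma := submodularity_ratio Z X SFR k in
      let lambda := sparse_lambda_min (cov_mx X) in
      let opt := OPT Z X k in
      [/\ R2 Z X SFR >= (1 - expR (- gamma)) * opt,
          (1 - expR (- gamma)) * opt
            >= (1 - expR (- lambda (2 * k)%N)) * opt &
          R2 Z X SFR >= (1 - expR (- lambda k)) * theta (lambda k) * opt].
Proof.
exists (fun x => 128^-1 * (2^-1) `^ (x^-1)); split.
  by exists 128^-1, 128^-1; split=> [||x _]; rewrite ?invr_gt0// !lexx.
move=> d T P n k Z X SFR k0 kn Z0 Z1 X0 X1 uC FR gamma lambda opt.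
have sC := sym_cov_mx X; have pC := psd_cov_mx X0 X1; have C1 := cov_mx_diag X1.
have fP S := R2_quadP Z0 Z1 X0 X1 (uC S).
have [S Sk optS] := OPT_attained Z X kn.
have [s [s0 step sk hs]] := forward_regression_greedy FR.
have opt0 : 0 <= opt by rewrite /opt optS (quad_ge0 pC fP).
have [SFRk SFRcard] := hs k (leqnn k).
split.
- rewrite /opt optS -sk; apply: (greedy_approx pC fP) => //.
  + exact: submodularity_ratio_le1.
  + by rewrite Sk.
  + move=> i ik; rewrite -setDUK; apply: submodularity_ratioP => //.
    * by have [] := hs i (ltnW ik).
    * by rewrite -[leqRHS]Sk subset_leq_card// finset.subsetDl.
    * by apply/finset.setP => x; rewrite !inE; case: (x \in s i); rewrite ?andbF.
- rewrite ler_wpM2r// lerD2l lerN2 ler_expR lerN2.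
  apply: sparse_lambda_le_ratio => //; first exact: leq_trans k0 kn.
  + by rewrite muln_gt0.
  (* The index [2k] arises from [#|SFR| <= k] plus [k] further variables. *)
  + by rewrite mul2n -addnn leq_add2r -sk.
- rewrite /opt optS -sk; apply: (greedy_approx_half sC pC C1 fP) => //.
  by move=> L; exact: sparse_coercive.
Qed.
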